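(* Let $I \subseteq A$ and $J \subseteq B$ be monomial ideals. Suppose that $\nu^*_\alpha(I) \in \mathbb{Z}$ for every $\alpha \in \mathbb{N}^r$. Then for every $k \in \mathbb{N}$, $$\overline{(I+J)^k} = \sum_{\ell=0}^{k} \overline{I^\ell}\cdot \overline{J^{k-\ell}}$$ in $S$.
   Context: $\mathbbm{k}$ is a field, $A = \mathbbm{k}[X_1,\dots,X_r]$, $B = \mathbbm{k}[Y_1,\dots,Y_s]$, $S = A\otimes_{\mathbbm{k}} B$; ideals of $A$ and $B$ and their integral closures are identified with their extensions to $S$. $\overline{\,\cdot\,}$ denotes integral closure, with $\overline{I^0} = A$. For a monomial ideal $I\subseteq A$ with minimal monomial generators whose exponent vectors form the columns of the $r\times m$ matrix $M$, and $\alpha\in\mathbb{N}^r$, $\nu^*_{\alpha}(I)$ is the optimal value of the linear program: maximize $\mathbf{1}^m\cdot \mathbf{y}$ subject to $M\mathbf{y} \le \alpha$, $\mathbf{y}\in\mathbb{R}^m_{\ge 0}$. *)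

(* Defs.v *)
From Stdlib Require Import Reals.
From mathcomp Require Import all_boot all_algebra.
From mathcomp Require Import mpoly.

Set Implicit Arguments.
Unset Strict Implicit.
Unset Printing Implicit Defensive.

Import GRing.Theory.

Section Ideals.
Variable R : comNzRingType.
Local Open Scope ring_scope.

(* An "ideal" is represented by its membership predicate. *)
Definition ideal_gen (P : R -> Prop) : R -> Prop :=
  fun x => exists l : seq (R * R),
    (forall p, p \in l -> P p.2) /\ x = \sum_(p <- l) p.1 * p.2.

Definition ideal_zero : R -> Prop := fun x => x = 0.
Definition ideal_unit : R -> Prop := fun _ => True.

Definition ideal_add (I J : R -> Prop) : R -> Prop :=
  fun x => exists a b, I a /\ J b /\ x = a + b.

Definition ideal_mul (I J : R -> Prop) : R -> Prop :=
  ideal_gen (fun x => exists a b, I a /\ J b /\ x = a * b).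

Fixpoint ideal_pow (I : R -> Prop) (k : nat) : R -> Prop :=
  match k with
  | 0 => ideal_unit
  | k'.+1 => ideal_mul (ideal_pow I k') I
  end.

Definition ideal_iclos (I : R -> Prop) : R -> Prop :=
  fun x => exists (n : nat) (a : nat -> R),
    (0 < n)%N /\ (forall i, (1 <= i <= n)%N -> ideal_pow I i (a i)) /\
    x ^+ n + \sum_(1 <= i < n.+1) a i * x ^+ (n - i) = 0.

Definition ideal_bigsum (k : nat) (F : nat -> R -> Prop) : R -> Prop :=
  foldr (fun l acc => ideal_add (F l) acc) ideal_zero (iota 0 k.+1).

Definition ideal_eq (I J : R -> Prop) : Prop := forall x, I x <-> J x.

End Ideals.

Section Poly.
Variable K : fieldType.
Local Open Scope ring_scope.

Definition monideal (n : nat) (G : seq 'X_{1..n}) : {mpoly K[n]} -> Prop :=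
  ideal_gen (fun p => exists m, m \in G /\ p = 'X_[m]).

(* ring embeddings A = k[X_1..X_r] -> S and B = k[Y_1..Y_s] -> S,
   S = k[X_1..X_r,Y_1..Y_s] = {mpoly K[r + s]} *)
Definition embA (r s : nat) (p : {mpoly K[r]}) : {mpoly K[r + s]} :=
  comp_mpoly [tuple ('X_(lshift s i) : {mpoly K[r + s]}) | i < r] p.
Definition embB (r s : nat) (p : {mpoly K[s]}) : {mpoly K[r + s]} :=
  comp_mpoly [tuple ('X_(rshift r i) : {mpoly K[r + s]}) | i < s] p.

Definition extA (r s : nat) (I : {mpoly K[r]} -> Prop) : {mpoly K[r + s]} -> Prop :=
  ideal_gen (fun y => exists x, I x /\ y = embA s x).
Definition extB (r s : nat) (J : {mpoly K[s]} -> Prop) : {mpoly K[r + s]} -> Prop :=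
  ideal_gen (fun y => exists x, J x /\ y = embB r x).
End Poly.

Definition minimal_gens (n : nat) (G : seq 'X_{1..n}) : Prop :=
  uniq G /\ forall m1 m2, m1 \in G -> m2 \in G ->
     (forall i, (m1 i <= m2 i)%N) -> m1 = m2.

(* Linear program for nu*_alpha(I): columns of M are the exponent vectors
   nth 0 G j (j < m = size G).  maximize sum_j y_j s.t. M y <= alpha, y >= 0. *)
Definition lp_obj (m : nat) (y : 'I_m -> R) : R :=
  \big[Rplus/R0]_(j < m) y j.

Definition lp_feasible (n : nat) (G : seq 'X_{1..n}) (alpha : 'X_{1..n})
    (y : 'I_(size G) -> R) : Prop :=
  (forall j, Rle R0 (y j)) /\
  forall i : 'I_n,
    Rle (\big[Rplus/R0]_(j < size G) Rmult (INR (nth 0%MM G j i)) (y j)) (INR (alpha i)).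

Arguments lp_feasible {n} G alpha y.

Definition nu_star_is (n : nat) (G : seq 'X_{1..n}) (alpha : 'X_{1..n}) (v : R) : Prop :=
  (exists y, lp_feasible G alpha y /\ lp_obj y = v) /\
  (forall y, lp_feasible G alpha y -> Rle (lp_obj y) v).

Arguments ideal_gen {R} P _.
Arguments ideal_add {R} I J _.
Arguments ideal_mul {R} I J _.
Arguments ideal_pow {R} I k _.
Arguments ideal_iclos {R} I _.
Arguments ideal_bigsum {R} k F _.
Arguments ideal_eq {R} I J.
Arguments monideal K {n} G _.
Arguments embA {K r} s p.
Arguments embB {K} r {s} p.
Arguments extA {K r} s I _.
Arguments extB {K} r {s} J _.
Arguments minimal_gens {n} G.
Arguments nu_star_is {n} G alpha v.

(* Main.v *)
(** All ideals in sight are spanned by monomials, and the integral closure of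
    the ideal spanned by the monomials with exponents in [P] is spanned by the
    monomials [x^m] with [N m] a sum of [N] exponents in [P], up to a
    nonnegative vector, for some [N > 0].  Such a monomial is a root of
    [X^N - x^(N m)], and sums of integral elements are integral by passing to
    the Rees algebra.  Conversely, in an equation of integral dependence of [f]
    one removes the exponents of [f] one at a time from the set of points needed
    to generate the convex hull of [P] and of the exponents of [f].

    If [x^a y^b] is integral over [(I + J)^k], then [N a] dominates a sum of [i]
    generators of [I] and [N b] a sum of [N k - i] generators of [J].  With
    [l = nu*_a(I)], feasibility of the scaled multiplicities gives [i <= N l].
    As [l] is an integer, [x^a] is integral over [I^l], where a rational
    optimal solution is obtained from a real one by Fourier-Motzkin
    elimination; and [y^b] is integral over [J^(k - l)] (take [k] for [l] when
    [l > k]). *)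

Require Import Defs.
From Stdlib Require Import Reals ZArith.
From HB Require Import structures.
From mathcomp Require Import all_boot all_order all_algebra.
From mathcomp Require Import mpoly ring lra zify.
From mathcomp Require Import boolp Rstruct.

Set Implicit Arguments.
Unset Strict Implicit.
Unset Printing Implicit Defensive.

Import Order.TTheory GRing.Theory Num.Theory.

(** * Sums of integral elements *)

Section Filtration.
Local Open Scope ring_scope.

(** Axiomatizes the powers of an ideal: [fil i] stands for the [i]-th power, and the axioms are
    those that make the Rees algebra a subring. *)
Record filtration (A : comNzRingType) := Filtration {
  fil :> nat -> A -> Prop;
  filT : forall x, fil 0 x;
  fil0 : forall i, fil i 0;
  filB : forall i x y, fil i x -> fil i y -> fil i (x - y);
  filM : forall i j x y, fil i x -> fil j y -> fil (i + j)%N (x * y) }.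

Variables (A : comNzRingType) (F : filtration A).

Definition integral_wrt (x : A) : Prop :=
  exists (n : nat) (a : nat -> A),
    (0 < n)%N /\ (forall i, (1 <= i <= n)%N -> F i (a i)) /\
    x ^+ n + \sum_(1 <= i < n.+1) a i * x ^+ (n - i) = 0.

(** The Rees algebra, the sum of the [F i t^i] inside [A[t]]; the classical boolean lets it carry a
    subring structure. *)
Definition rees : {pred {poly A}} := fun p => `[< forall i, F i p`_i >].

Lemma reesP (p : {poly A}) : reflect (forall i, F i p`_i) (p \in rees).
Proof. exact: asboolP. Qed.

Lemma fil_sum (I : Type) (r : seq I) (P : pred I) (G : I -> A) i :
  (forall j, P j -> F i (G j)) -> F i (\sum_(j <- r | P j) G j).
Proof.
move=> FG; elim/big_ind: _ => [|x y Fx Fy|//]; first exact: fil0.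
by rewrite -[y]opprK; apply: filB => //; rewrite -[- y]add0r; apply: filB => //; exact: fil0.
Qed.

Lemma rees_subring : subring_closed rees.
Proof.
split=> [|p q /reesP Fp /reesP Fq|p q /reesP Fp /reesP Fq]; apply/reesP=> i.
- by rewrite coef1; case: i => [|i]; [exact: filT | exact: fil0].
- by rewrite coefB; apply: filB.
- rewrite coefM; apply: fil_sum => j _.
  by have := filM (Fp j) (Fq (i - j)%N); rewrite subnKC // -ltnS.
Qed.

HB.instance Definition _ := GRing.isSubringClosed.Build {poly A} rees rees_subring.

Definition rees_ring := {p : {poly A} | p \in rees}.

HB.instance Definition _ := SubChoice.on rees_ring.
HB.instance Definition _ := [SubChoice_isSubComNzRing of rees_ring by <:].

(* An equation of integral dependence of x over the filtration is the same as
   one of x t over the Rees algebra, read off in degree n. *)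
Lemma integral_wrtP (x : A) :
  integral_wrt x <-> integralOver (val : rees_ring -> {poly A}) (x *: 'X).
Proof.
split=> [[n [a [n_gt0 [Fa eq0]]]]|[p mon_p]].
  (* Coefficients of the homogenized equation: with weight [t^(n - j)] on the [j]-th one, every term
     at [x t] is a multiple of [t^n]. *)
  pose E j : {poly A} := if j == n then 1 else a (n - j)%N *: 'X^(n - j).
  have EnE : E n.+1.-1 = 1 by rewrite /E eqxx.
  apply: (@integral_root_monic _ _ _ _ (\poly_(j < n.+1) E j)).
  - by rewrite monicE lead_coef_poly // EnE // oner_eq0.
  - rewrite /root horner_poly big_ord_recr /= /E eqxx mul1r.
    rewrite (eq_bigr (fun j : 'I_n => (a (n - j)%N * x ^+ j) *: 'X^n)); last first.
      move=> j _; rewrite ltn_eqF // exprZn -scalerAl -scalerAr scalerA -exprD.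
      by rewrite subnK // ltnW.
    rewrite -scaler_suml exprZn -scalerDl addrC.
    suff -> : \sum_(j < n) a (n - j)%N * x ^+ j =
              \sum_(1 <= i < n.+1) a i * x ^+ (n - i) by rewrite eq0 scale0r.
    rewrite big_add1 /= big_nat_rev /= add0n big_mkord; apply: eq_bigr => j _.
    by rewrite subnSK // subKn // ltnW.
  - apply/integral_poly=> j; rewrite coef_poly; case: ifP => [lejn|_]; last exact: integral0.
    suff Ej : E j \in rees by exact: (integral_id _ (Sub (E j) Ej : rees_ring)).
    rewrite /E; case: eqP => [_|nej]; first exact: rpred1.
    apply/reesP=> i; rewrite coefZ coefXn; case: eqP => [->|_]; last first.
      by rewrite mulr0; exact: fil0.
    rewrite mulr1; apply: Fa; rewrite leq_subr subn_gt0 andbT.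
    by rewrite ltn_neqAle -ltnS lejn andbT; apply/eqP.
rewrite /root => /eqP p0.
have [n size_p] : exists n, size p = n.+1.
  by exists (size p).-1; rewrite prednK // lt0n size_poly_eq0 monic_neq0.
have pn : p`_n = 1 by move/monicP: mon_p; rewrite lead_coefE size_p.
have : (map_poly val p).[x *: 'X]`_n = 0 by rewrite p0 coef0.
(* As [(x t)^j] is homogeneous of degree [j], only the coefficient of [t^(n - j)] in [p_j] reaches
   degree [n]. *)
have -> : (map_poly val p).[x *: 'X]`_n = \sum_(j < n.+1) (val p`_j)`_(n - j) * x ^+ j.
  rewrite (@horner_coef_wide _ n.+1); last by rewrite -size_p size_poly.
  rewrite coef_sum; apply: eq_bigr => j _.
  rewrite coef_map exprZn -scalerAr coefZ coefMXn ltnNge -ltnS ltn_ord /=.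
  by rewrite mulrC.
rewrite big_ord_recr /= pn subnn coef1 mul1r addrC => eq0.
exists n, (fun i => (val p`_(n - i))`_i); split; last split.
- rewrite lt0n; apply/eqP=> n0; move: eq0; rewrite n0 big_ord0 addr0 expr0 => /eqP.
  by rewrite oner_eq0.
- by move=> i _; have /reesP := valP p`_(n - i).
- rewrite -[RHS]eq0; congr (_ + _).
  rewrite big_add1 /= big_nat_rev /= add0n big_mkord; apply: eq_bigr => j _.
  by rewrite subnSK // subKn // ltnW.
Qed.

Lemma integral_wrtD x y : integral_wrt x -> integral_wrt y -> integral_wrt (x + y).
Proof.
move=> /integral_wrtP ix /integral_wrtP iy; apply/integral_wrtP.
by rewrite scalerDl; apply: integral_add.
Qed.

Lemma integral_wrt_root x n : (0 < n)%N -> F n (x ^+ n) -> integral_wrt x.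
Proof.
move=> n_gt0 Fx; exists n, (fun i => if i == n then - x ^+ n else 0); split=> //.
split=> [i _|]; first case: eqP => [->|_]; last 2 first.
- exact: fil0.
- rewrite big_nat_recr //= eqxx subnn mulr1 big_nat big1 ?add0r ?subrr // => i /andP[_ lt_in].
  by rewrite ltn_eqF // mul0r.
by rewrite -sub0r; apply: filB => //; exact: fil0.
Qed.

Lemma integral_wrt_sum (I : eqType) (r : seq I) (G : I -> A) :
  (forall j, j \in r -> integral_wrt (G j)) -> integral_wrt (\sum_(j <- r) G j).
Proof.
move=> iG; rewrite big_seq; elim/big_ind: _ => //; last exact: integral_wrtD.
by apply: (@integral_wrt_root _ 1) => //; rewrite expr1; exact: fil0.
Qed.

End Filtration.

(** * Fourier-Motzkin elimination *)

Section FourierMotzkin.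
Local Open Scope ring_scope.

(* A constraint [c] in the variables [x_0, ..., x_(n-1)] stands for
   [c 0 * x_0 + ... + c (n-1) * x_(n-1) + c n >= 0]. *)
Fixpoint lin_eval (E : realFieldType) (c : nat -> rat) (x : seq E) : E :=
  if x is t :: x' then ratr (c 0%N) * t + lin_eval (fun i => c i.+1) x'
  else ratr (c 0%N).

Lemma lin_evalE (E : realFieldType) (c : nat -> rat) (x : seq E) :
  lin_eval c x = \sum_(i < size x) ratr (c i) * x`_i + ratr (c (size x)).
Proof.
elim: x c => [|t x IHx] c /=; first by rewrite big_ord0 add0r.
by rewrite IHx big_ord_recl addrA.
Qed.

Lemma lin_eval0 (E : realFieldType) (x : seq E) : lin_eval (fun=> 0) x = 0.
Proof. by elim: x => [|t x /= ->]; rewrite /= rmorph0 ?mul0r ?addr0. Qed.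

Lemma lin_evalD (E : realFieldType) u v (c d : nat -> rat) (x : seq E) :
  lin_eval (fun i => u * c i + v * d i) x =
  ratr u * lin_eval c x + ratr v * lin_eval d x.
Proof.
elim: x c d => [|t x IHx] c d /=; first by rewrite rmorphD !rmorphM.
rewrite IHx rmorphD !rmorphM /= mulrDl !mulrDr !mulrA -!addrA; congr (_ + _).
by rewrite addrCA.
Qed.

Lemma ratr_id (u : rat) : ratr u = u :> rat.
Proof. exact: divq_num_den. Qed.

(** The largest element of [lo] serves, or the least of [up] when [lo] is empty. *)
Lemma between_seqs (lo up : seq rat) :
  (forall a b, a \in lo -> b \in up -> a <= b) ->
  exists t, (forall a, a \in lo -> a <= t) /\ (forall b, b \in up -> t <= b).
Proof.
case: lo => [|a0 lo]; first case: up => [|b0 up] le_lu.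
- by exists 0.
- exists (\big[Order.min/b0]_(b <- up) b); split=> // b.
  rewrite inE => /predU1P[->|b_up]; last exact: ge_bigmin_seq.
  exact: bigmin_le_id.
- move=> le_lu; exists (\big[Order.max/a0]_(a <- lo) a); split=> [a|b b_up].
    rewrite inE => /predU1P[->|a_lo]; first exact: bigmax_ge_id.
    exact: le_bigmax_seq.
  rewrite big_seq; apply: bigmax_le => [|a a_lo]; apply: le_lu => //.
    by rewrite mem_head.
  by rewrite inE a_lo orbT.
Qed.

(** Induction on the number of variables: eliminating the first one keeps the coefficients rational,
    and a rational solution of the projected system extends back. *)
Lemma rational_solution (E : realFieldType) (x : seq E) (J : finType)
    (c : J -> nat -> rat) :
  (forall j, 0 <= lin_eval (c j) x) ->
  exists q : seq rat, size q = size x /\ forall j, 0 <= lin_eval (c j) q.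
Proof.
elim: x J c => [|t x IHx] J c c_ge0.
  by exists [::]; split=> // j; have := c_ge0 j; rewrite /= !ler0q.
pose sh j i := c j i.+1.
(* Two constraints with head coefficients of opposite signs are combined so that [t] cancels;
   constraints free of [t] are kept; all other indices get the trivial [0 >= 0]. *)
pose d (e : (J * J) + J) : nat -> rat := match e with
  | inl (j, k) => if (0 < c j 0%N) && (c k 0%N < 0)
                  then fun i => c j 0%N * sh k i + (- c k 0%N) * sh j i
                  else fun=> 0
  | inr j => if c j 0%N == 0 then sh j else fun=> 0
  end.
have [[[j k]|j]|q [size_q q_ge0]] := IHx _ d.
- rewrite /d; case: ifP => [/andP[cj ck]|_]; last by rewrite lin_eval0.
  rewrite lin_evalD rmorphN /=; move: (c_ge0 j) (c_ge0 k) => /=.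
  rewrite -/(sh j) -/(sh k) => evj evk.
  have -> : ratr (c j 0%N) * lin_eval (sh k) x + - ratr (c k 0%N) * lin_eval (sh j) x
    = ratr (c j 0%N) * (ratr (c k 0%N) * t + lin_eval (sh k) x)
    + - ratr (c k 0%N) * (ratr (c j 0%N) * t + lin_eval (sh j) x).
    by ring.
  apply: addr_ge0; apply: mulr_ge0 => //; first by rewrite ler0q ltW.
  by rewrite oppr_ge0 lerq0 ltW.
- rewrite /d; case: eqP => [cj0|_]; last by rewrite lin_eval0.
  by move: (c_ge0 j); rewrite /= cj0 rmorph0 mul0r add0r.
(* The bound that constraint [j] puts on the eliminated variable: lower if its head coefficient is
   positive, upper if negative. *)
pose b j := - lin_eval (sh j) q / c j 0%N.
have [a1 a2 |t' [lo_t t_up]] := @between_seqs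
    [seq b j | j <- enum J & 0 < c j 0%N] [seq b j | j <- enum J & c j 0%N < 0].
  case/mapP=> j; rewrite mem_filter => /andP[cj _] ->.
  case/mapP=> k; rewrite mem_filter => /andP[ck _] ->.
  have := q_ge0 (inl (j, k)); rewrite /d cj ck /= lin_evalD !ratr_id /b.
  by rewrite ler_pdivrMr // mulrAC ler_ndivlMr //; lra.
exists (t' :: q); rewrite /= size_q; split=> // j; rewrite -/(sh j) ratr_id.
have [cj|cj|cj0] := ltrgtP 0 (c j 0%N).
- have /lo_t : b j \in [seq b j | j <- enum J & 0 < c j 0%N].
    by apply: map_f; rewrite mem_filter cj mem_enum.
  by rewrite /b ler_pdivrMr //; lra.
- have /t_up : b j \in [seq b j | j <- enum J & c j 0%N < 0].
    by apply: map_f; rewrite mem_filter cj mem_enum.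
  by rewrite /b ler_ndivlMr //; lra.
- by have := q_ge0 (inr j); rewrite /d -cj0 eqxx mul0r add0r.
Qed.

End FourierMotzkin.

(** * Exponents of powers and of integral closures *)

Section Exponents.
Variable n : nat.
Implicit Types (P Q : 'X_{1..n} -> Prop) (a b m : 'X_{1..n}).

Definition upclosed P := forall a b, P a -> (a <= b)%MM -> P b.

(** The exponents in the [k]-th power of the ideal generated by the monomials with exponents in [P];
    for [k = 0] the empty sum admits every exponent, as the unit ideal requires. *)
Definition mpow P (k : nat) m : Prop :=
  exists l : seq 'X_{1..n}, [/\ size l = k, forall x, x \in l -> P x
    & (\sum_(x <- l) x <= m)%MM].

(* [m] lies in [k] times the Newton polyhedron of [P]. *)
Definition newt P (k : nat) m : Prop :=
  exists2 N, (0 < N)%N & mpow P (N * k) (m *+ N)%MM.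

Lemma lem_add a b a' b' : (a <= a')%MM -> (b <= b')%MM -> (a + b <= a' + b')%MM.
Proof.
by move=> /mnm_lepP le1 /mnm_lepP le2; apply/mnm_lepP => i; rewrite !mnmDE leq_add.
Qed.

Lemma lem_mul2r N a b : (0 < N)%N -> ((a *+ N)%MM <= (b *+ N)%MM)%MM = (a <= b)%MM.
Proof.
by move=> N_gt0; apply: eq_forallb => i; rewrite !mulmnE leq_pmul2r.
Qed.

Lemma mpow_up P k : upclosed (mpow P k).
Proof.
by move=> a b [l [szl Pl le_la]] le_ab; exists l; split=> //; apply: lepm_trans le_ab.
Qed.

Lemma mpow0 P m : mpow P 0 m.
Proof. by exists [::]; split=> //; rewrite big_nil; apply/mnm_lepP=> i; rewrite mnm0E. Qed.

Lemma mpow1 P m : P m -> mpow P 1 m.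
Proof.
move=> Pm; exists [:: m]; split=> // [x|]; first by rewrite inE => /eqP->.
by rewrite big_seq1 lepm_refl.
Qed.

Lemma mpowD P i j a b : mpow P i a -> mpow P j b -> mpow P (i + j) (a + b)%MM.
Proof.
move=> [l1 [<- Pl1 le1]] [l2 [<- Pl2 le2]]; exists (l1 ++ l2).
rewrite size_cat big_cat; split=> // [x|]; last exact: lem_add.
by rewrite mem_cat => /orP[/Pl1|/Pl2].
Qed.

Lemma mpowMn P k m N : mpow P k m -> mpow P (N * k) (m *+ N)%MM.
Proof.
move=> Pm; elim: N => [|N IHN]; first exact: mpow0.
by rewrite mulSn mulmS; apply: mpowD.
Qed.

(** The binomial expansion of [(I + J)^k] on exponents: the summands are sorted into those from [P]
    and those from [Q]. *)
Lemma mpow_split P Q k m : mpow (fun x => P x \/ Q x) k m ->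
  exists i j b c, [/\ (i + j)%N = k, mpow P i b, mpow Q j c & (b + c <= m)%MM].
Proof.
move=> [l [<- PQl]]; elim: l m PQl => [|x l IHl] m PQl.
  move=> _; exists 0%N, 0%N, 0%MM, 0%MM; split=> //; try exact: mpow0.
  by apply/mnm_lepP=> i; rewrite mnmDE mnm0E.
rewrite big_cons => le_m.
have [y yl|i [j [b [c [Eij Pb Qc le_bc]]]]] := IHl (\sum_(y <- l) y)%MM _ (lepm_refl _).
  by apply: PQl; rewrite inE yl orbT.
have [Px|Qx] := PQl x (mem_head _ _).
  exists i.+1, j, (x + b)%MM, c; rewrite addSn Eij; split=> //.
    by apply: (@mpowD _ 1) => //; apply: mpow1.
  by rewrite -addmA; apply: lepm_trans le_m; apply: lem_add; rewrite ?lepm_refl.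
exists i, j.+1, b, (x + c)%MM; rewrite addnS Eij; split=> //.
  by apply: (@mpowD _ 1) => //; apply: mpow1.
rewrite addmA [(b + x)%MM]addmC -addmA; apply: lepm_trans le_m.
by apply: lem_add; rewrite ?lepm_refl.
Qed.

Lemma mpow_sub P Q k m : (forall x, P x -> Q x) -> mpow P k m -> mpow Q k m.
Proof. by move=> sPQ [l [szl Pl le_l]]; exists l; split=> // x /Pl/sPQ. Qed.

Lemma mpow_leq P j k m : (j <= k)%N -> mpow P k m -> mpow P j m.
Proof.
move=> le_jk [l [szl Pl le_l]]; exists (take j l); split.
- by rewrite size_take_min szl; apply/minn_idPl.
- by move=> x /mem_take/Pl.
- apply: lepm_trans le_l; rewrite -{2}(cat_take_drop j l) big_cat; exact: lem_addr.
Qed.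

Lemma mpow_sum1 a k m : mpow (eq a) k m -> (a *+ k <= m)%MM.
Proof.
move=> [l [<- al]]; suff -> : (\sum_(x <- l) x = a *+ size l)%MM by [].
elim: l al => [|x l IHl] al; first by rewrite big_nil mulm0n.
rewrite big_cons /= mulmS IHl => [|y yl]; first by rewrite -(al x) ?mem_head.
by apply: al; rewrite inE yl orbT.
Qed.

(** The list of [N * k] summands is cut into [N] blocks of length [k]. *)
Lemma mpow_mul P k N m : mpow P (N * k) m -> mpow (mpow P k) N m.
Proof.
elim: N m => [|N IHN] m; first by move=> _; apply: mpow0.
rewrite mulSn => -[l [szl Pl]]; rewrite -(cat_take_drop k l) big_cat => le_m.
apply: mpow_up le_m; apply: (@mpowD _ 1).
  apply: mpow1; exists (take k l); rewrite lepm_refl size_takel ?szl ?leq_addr //.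
  by split=> // x /mem_take/Pl.
apply: IHN; exists (drop k l); rewrite lepm_refl size_drop szl addKn.
by split=> // x /mem_drop/Pl.
Qed.

Lemma mpow_mpow1 P k m : mpow (mpow P 1) k m -> mpow P k m.
Proof.
move=> [l [<- Pl le_l]]; apply: mpow_up le_l; elim: l Pl => [|x l IHl] Pl.
  exact: mpow0.
rewrite big_cons; apply: (@mpowD _ 1); first by apply: Pl; rewrite mem_head.
by apply: IHl => y yl; apply: Pl; rewrite inE yl orbT.
Qed.

Lemma mpow_newt P k m : mpow P k m -> newt P k m.
Proof. by exists 1%N => //; rewrite mul1n mulm1n. Qed.

Lemma newt_up P k : upclosed (newt P k).
Proof.
move=> a b [N N_gt0 Pa] le_ab; exists N => //.
by apply: mpow_up Pa _; rewrite lem_mul2r.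
Qed.

Lemma newt_sub P Q k m : (forall x, P x -> Q x) -> newt P k m -> newt Q k m.
Proof. by move=> sPQ [N N_gt0 Pm]; exists N => //; apply: mpow_sub Pm. Qed.

Lemma newt_leq P j k m : (j <= k)%N -> newt P k m -> newt P j m.
Proof.
move=> le_jk [N N_gt0 Pm]; exists N => //; apply: mpow_leq Pm.
by rewrite leq_pmul2l.
Qed.

Lemma newtD P i j a b : newt P i a -> newt P j b -> newt P (i + j) (a + b)%MM.
Proof.
move=> [N N_gt0 Pa] [M M_gt0 Pb]; exists (N * M)%N; first by rewrite muln_gt0 N_gt0.
have := mpowD (mpowMn M Pa) (mpowMn N Pb).
have -> : (M * (N * i) + N * (M * j) = N * M * (i + j))%N by ring.
suff -> : (a *+ N *+ M + b *+ M *+ N)%MM = ((a + b) *+ (N * M))%MM by [].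
by apply/mnmP=> x; rewrite !(mnmDE, mulmnE); ring.
Qed.

Lemma newtV P k m N : (0 < N)%N -> newt P (N * k) (m *+ N)%MM -> newt P k m.
Proof.
move=> N_gt0 [M M_gt0]; rewrite mulnA => Pm.
exists (M * N)%N; first by rewrite muln_gt0 M_gt0.
suff -> : (m *+ (M * N) = m *+ N *+ M)%MM by [].
by apply/mnmP=> x; rewrite !mulmnE; ring.
Qed.

(** For [j = k = 1] this is idempotence of integral closure. The summands add up in the polyhedron
    by [newtD], and [newtV] divides by the scaling factor. *)
Lemma newt_newt P j k m : newt (newt P k) j m -> newt P (j * k) m.
Proof.
move=> [N N_gt0 [l [szl Pl le_l]]]; apply: (newtV N_gt0).
apply: newt_up le_l; rewrite mulnA -szl; elim: l Pl {szl} => [|x l IHl] Pl.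
  exact/mpow_newt/mpow0.
rewrite big_cons /= mulSn; apply: newtD; first by apply: Pl; rewrite mem_head.
by apply: IHl => y yl; apply: Pl; rewrite inE yl orbT.
Qed.

(* Over [P] and [a], the point [(k + l) a] is a sum of points of the [k]-th and
   [l]-th dilates only trivially, unless cancelling the copies of [a] exhibits
   [a] as a point over [P] alone. *)
Lemma newt_cancel P a k l m1 m2 :
    newt (fun x => P x \/ a = x) k m1 -> newt (fun x => P x \/ a = x) l m2 ->
    (m1 + m2)%MM = (a *+ (k + l))%MM ->
  newt P 1 a \/ (m1 = a *+ k /\ m2 = a *+ l)%MM.
Proof.
move=> [N1 N1_gt0 /mpow_split[i1 [j1 [b1 [c1 [E1 Pb1 /mpow_sum1 ac1 le1]]]]]].
move=> [N2 N2_gt0 /mpow_split[i2 [j2 [b2 [c2 [E2 Pb2 /mpow_sum1 ac2 le2]]]]]] Em.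
(* At the common scale [N1 * N2], this number counts the points taken from [P]. If it is positive,
   subtracting the copies of [a] leaves that many copies of [a] above a sum of that many points of
   [P]. *)
have [i_eq0|] := posnP (N2 * i1 + N1 * i2); last first.
  left; exists (N2 * i1 + N1 * i2)%N => //; rewrite muln1.
  apply: mpow_up (mpowD (mpowMn N2 Pb1) (mpowMn N1 Pb2)) _.
  apply/mnm_lepP=> x; rewrite !(mnmDE, mulmnE).
  move/mnm_lepP/(_ x): le1; move/mnm_lepP/(_ x): le2; move/mnm_lepP/(_ x): ac1.
  move/mnm_lepP/(_ x): ac2; move/mnmP/(_ x): Em; rewrite !(mnmDE, mulmnE).
  move: (b1 x) (b2 x) (c1 x) (c2 x) (m1 x) (m2 x) (a x).
  move=> B1 B2 C1 C2 M1 M2 A Em h1 h2 h3 h4.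
  have h5 : (N2 * (B1 + C1) + N1 * (B2 + C2) <= N2 * (M1 * N1) + N1 * (M2 * N2))%N.
    by rewrite leq_add // leq_mul.
  have h6 : (N2 * (M1 * N1) + N1 * (M2 * N2) = A * (N2 * (i1 + j1) + N1 * (i2 + j2)))%N.
    by rewrite E1 E2; transitivity ((M1 + M2) * (N1 * N2))%N; [|rewrite Em]; ring.
  have h7 : (N2 * (A * j1) + N1 * (A * j2) <= N2 * C1 + N1 * C2)%N.
    by rewrite leq_add // leq_mul.
  by nia.
have {Pb1 Pb2 i_eq0} [i10 i20] : i1 = 0%N /\ i2 = 0%N by split; nia.
(* With no point of [P] involved, [m1] dominates [k a] and [m2] dominates [l a]; the value of
   [m1 + m2] forces equality. *)
right; move: E1 E2; rewrite i10 i20 !add0n => Ej1 Ej2; subst j1 j2.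
have ak1 : (a *+ k <= m1)%MM.
  rewrite -(@lem_mul2r N1) //; apply: lepm_trans le1.
  apply: lepm_trans (lem_addl _ _); apply: lepm_trans ac1.
  by apply/mnm_lepP=> x; rewrite !mulmnE; lia.
have ak2 : (a *+ l <= m2)%MM.
  rewrite -(@lem_mul2r N2) //; apply: lepm_trans le2.
  apply: lepm_trans (lem_addl _ _); apply: lepm_trans ac2.
  by apply/mnm_lepP=> x; rewrite !mulmnE; lia.
by split; apply/mnmP=> x; move/mnm_lepP/(_ x): ak1; move/mnm_lepP/(_ x): ak2;
  move/mnmP/(_ x): Em; rewrite !(mnmDE, mulmnE); lia.
Qed.

End Exponents.

(** * Monomial ideals as spans of monomials *)

Section IdealGen.
Variables (A : comNzRingType) (T : A -> Prop).
Local Open Scope ring_scope.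

Lemma ideal_gen_base x : T x -> ideal_gen T x.
Proof.
move=> Tx; exists [:: (1, x)]; split=> [p|]; first by rewrite inE => /eqP->.
by rewrite big_seq1 mul1r.
Qed.

Lemma ideal_gen0 : ideal_gen T 0.
Proof. by exists [::]; rewrite big_nil. Qed.

Lemma ideal_genD x y : ideal_gen T x -> ideal_gen T y -> ideal_gen T (x + y).
Proof.
move=> [l [Tl ->]] [l' [Tl' ->]]; exists (l ++ l'); rewrite big_cat; split=> // p.
by rewrite mem_cat => /orP[/Tl|/Tl'].
Qed.

Lemma ideal_genM c x : ideal_gen T x -> ideal_gen T (c * x).
Proof.
move=> [l [Tl ->]]; exists [seq (c * p.1, p.2) | p <- l]; split.
  by move=> _ /mapP[p pl ->]; exact: (Tl p).
by rewrite big_map mulr_sumr; apply: eq_bigr => p _; rewrite mulrA.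
Qed.

End IdealGen.

Section MonomialSpan.
Variables (K : fieldType) (n : nat).
Implicit Types (P Q : 'X_{1..n} -> Prop) (f g : {mpoly K[n]}).
Local Open Scope ring_scope.

Definition mspan P f : Prop := forall m, m \in msupp f -> P m.

Lemma mspan_ext P Q : (forall m, P m <-> Q m) -> mspan P = mspan Q.
Proof. by move=> PQ; congr mspan; apply/funext=> m; apply/propext. Qed.

Lemma mspan_sub P Q f : (forall m, P m -> Q m) -> mspan P f -> mspan Q f.
Proof. by move=> sPQ Pf m /Pf/sPQ. Qed.

Lemma mspan0 P : mspan P 0.
Proof. by move=> m; rewrite msupp0. Qed.

Lemma mspanD P f g : mspan P f -> mspan P g -> mspan P (f + g).
Proof. by move=> Pf Pg m /msuppD_le; rewrite mem_cat => /orP[/Pf|/Pg]. Qed.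

Lemma mspanB P f g : mspan P f -> mspan P g -> mspan P (f - g).
Proof.
by move=> Pf Pg; apply: mspanD => // m; rewrite (perm_mem (msuppN g)); apply: Pg.
Qed.

Lemma mspan_sum P (I : eqType) (r : seq I) (Q : pred I) (F : I -> {mpoly K[n]}) :
  (forall i, i \in r -> Q i -> mspan P (F i)) -> mspan P (\sum_(i <- r | Q i) F i).
Proof.
move=> PF; rewrite big_seq_cond; elim/big_ind: _ => [||i /andP[]]; first exact: mspan0.
  exact: mspanD.
exact: PF.
Qed.

Lemma mspanM P Q f g : mspan P f -> mspan Q g ->
  mspan (fun m => exists a b, [/\ P a, Q b & (a + b = m)%MM]) (f * g).
Proof.
move=> Pf Qg m /msuppM_le/allpairsP[[a b] /= [af bg ->]].
by exists a, b; split; [exact: Pf | exact: Qg | ].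
Qed.

Lemma mspanX P m : P m -> mspan P 'X_[m].
Proof. by move=> Pm m'; rewrite msuppX inE => /eqP->. Qed.

Lemma mspanZX P c m : P m -> mspan P (c *: 'X_[m]).
Proof. by move=> Pm m' /msuppZ_le; rewrite msuppX inE => /eqP->. Qed.

(** [upclosed] makes the span stable under multiplication; conversely a polynomial is the sum of its
    terms. Every translation from ideals to exponents except that of sums goes through this. *)
Lemma ideal_gen_mspan P (T : {mpoly K[n]} -> Prop) : upclosed P ->
    (forall f, T f -> mspan P f) -> (forall m, P m -> ideal_gen T 'X_[m]) ->
  ideal_gen T = mspan P.
Proof.
move=> upP TP PT; apply/funext=> f; apply/propext; split.
  move=> [l [Tl ->]]; apply: mspan_sum => p /Tl/TP Pp _.
  have := @mspanM (fun=> True) P p.1 p.2 (fun _ _ => I) Pp.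
  by apply: mspan_sub => m [a [b [_ Pb <-]]]; apply: upP Pb (lem_addl _ _).
move=> Pf; rewrite [f]mpolyE big_seq.
elim/big_ind: _ => [||m mf]; [exact: ideal_gen0 | exact: ideal_genD |].
by rewrite -mul_mpolyC; apply/ideal_genM/PT/Pf.
Qed.

Lemma monideal_mspan (G : seq 'X_{1..n}) :
  monideal K G = mspan (mpow (fun m => m \in G) 1).
Proof.
apply: ideal_gen_mspan => [|_ [m [mG ->]]|m [[|g [|g' l]] [//= _ Gg le_gm]]].
- exact: mpow_up.
- by apply: mspanX; apply: mpow1.
move: le_gm; rewrite big_seq1 => /submK <-; rewrite mpolyXD; apply: ideal_genM.
by apply: ideal_gen_base; exists g; split=> //; apply: Gg; rewrite mem_head.
Qed.

Lemma ideal_add_mspan P Q :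
  ideal_add (mspan P) (mspan Q) = mspan (fun m => P m \/ Q m).
Proof.
apply/funext=> f; apply/propext; split.
  move=> [g [h [Pg [Qh ->]]]]; apply: mspanD.
    by move: Pg; apply: mspan_sub => m; left.
  by move: Qh; apply: mspan_sub => m; right.
move=> PQf; exists (\sum_(m <- msupp f | `[< P m >]) f@_m *: 'X_[m]).
exists (\sum_(m <- msupp f | ~~ `[< P m >]) f@_m *: 'X_[m]); split; last split.
- by apply: mspan_sum => m _ /asboolP Pm; apply: mspanZX.
- by apply: mspan_sum => m /PQf[Pm /asboolP//|Qm _]; apply: mspanZX.
- by rewrite {1}[f]mpolyE (bigID (fun m => `[< P m >])).
Qed.

Lemma ideal_mul_mspan P Q : ideal_mul (mspan P) (mspan Q) =
  mspan (fun m => exists a b, [/\ P a, Q b & (a + b <= m)%MM]).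
Proof.
apply: ideal_gen_mspan => [m m'|_ [f [g [Pf [Qg ->]]]]|m [a [b [Pa Qb le_m]]]].
- move=> [a [b [Pa Qb le_m]]] le_mm'; exists a, b; split=> //.
  exact: lepm_trans le_mm'.
- have := mspanM Pf Qg; apply: mspan_sub => m [a [b [Pa Qb <-]]].
  by exists a, b; rewrite lepm_refl.
- rewrite -(submK le_m) mpolyXD; apply/ideal_genM/ideal_gen_base.
  by exists 'X_[a], 'X_[b]; rewrite mpolyXD; split; [|split=> //]; apply: mspanX.
Qed.

Lemma ideal_pow_mspan P k : upclosed P ->
  ideal_pow (mspan P) k = mspan (mpow P k).
Proof.
move=> upP; elim: k => [|k IHk] /=.
  by apply/funext=> f; apply/propext; split=> // _ m _; apply: mpow0.
rewrite IHk ideal_mul_mspan; apply: mspan_ext => m; split=> [[a [b [Pa Pb le_m]]]|].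
  by apply: mpow_up le_m; rewrite -addn1; apply: mpowD => //; apply: mpow1.
rewrite -add1n => -[[|x l] [//= [szl] Pl]]; rewrite big_cons addmC => le_m.
exists (\sum_(y <- l) y)%MM, x; split=> //; last by apply: Pl; rewrite mem_head.
exists l; rewrite lepm_refl; split=> // y yl.
by apply: Pl; rewrite inE yl orbT.
Qed.

Lemma mspan_exp P k f : mspan P f -> mspan (mpow P k) (f ^+ k).
Proof.
move=> Pf; elim: k => [|k IHk]; first by move=> m _; apply: mpow0.
rewrite exprSr; have := mspanM IHk Pf; apply: mspan_sub => m [a [b [Pa Pb <-]]].
by rewrite -addn1; apply: mpowD => //; apply: mpow1.
Qed.

Lemma mspan_mpowM P i j f g :
  mspan (mpow P i) f -> mspan (mpow P j) g -> mspan (mpow P (i + j)) (f * g).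
Proof.
move=> Pf Pg; have := mspanM Pf Pg.
by apply: mspan_sub => m [a [b [Pa Pb <-]]]; apply: mpowD.
Qed.

Definition mspan_filtration P : filtration {mpoly K[n]} :=
  @Filtration _ (fun i => mspan (mpow P i))
    (fun f m _ => mpow0 P m) (fun i => @mspan0 _) (fun i => @mspanB _)
    (@mspan_mpowM P).

Lemma mcoeffM_uniq f g a b :
    (forall m1 m2, m1 \in msupp f -> m2 \in msupp g -> (m1 + m2 = a + b)%MM ->
       m1 = a /\ m2 = b) ->
  (f * g)@_(a + b) = f@_a * g@_b.
Proof.
move=> uniq_ab; rewrite mcoeffM.
have lta : (mdeg a < (mdeg (a + b)).+1)%N by rewrite ltnS mdegD leq_addr.
have ltb : (mdeg b < (mdeg (a + b)).+1)%N by rewrite ltnS mdegD leq_addl.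
rewrite (bigD1 (BMultinom lta, BMultinom ltb)) //= big1 ?addr0 //.
move=> [m1 m2] /= /andP[/eqP Em ne_ab]; apply/eqP; rewrite mulf_eq0 !mcoeff_eq0.
rewrite -negb_and; apply/negP=> /andP[m1f m2g].
have [E1 E2] := uniq_ab _ _ m1f m2g (esym Em).
by case/eqP: ne_ab; congr (_, _); apply: val_inj.
Qed.

(* If [a] is not in the Newton polyhedron of [P], then in an equation of
   integral dependence of degree [d] the monomial [d a] only comes from the
   [d]-th power of the term of exponent [a]. *)
Lemma integral_newt_step P Q a f :
    (forall m, P m -> Q m) -> a \in msupp f ->
    integral_wrt (mspan_filtration P) f ->
    mspan (newt (fun x => Q x \/ a = x) 1) f ->
  newt Q 1 a.
Proof.
move=> sPQ af [d [c [d_gt0 [Pc eq0]]]] Qaf; apply: contrapT => Na.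
have Qafk k : mspan (newt (fun x => Q x \/ a = x) k) (f ^+ k).
  have := mspan_exp (k := k) Qaf; apply: mspan_sub => m /mpow_newt/newt_newt.
  by rewrite muln1.
(* By [newt_cancel], the only way to write [(k + 1) a] as an exponent of [f^k] plus one of [f] is
   [k a + a]. *)
have coef_exp k : (f ^+ k)@_(a *+ k) = f@_a ^+ k.
  elim: k => [|k IHk]; first by rewrite mulm0n !expr0 mcoeff1 eqxx.
  rewrite !exprSr -IHk mulmSr; apply: mcoeffM_uniq => m1 m2 m1f m2f.
  rewrite -mulmSr -addn1 => Em.
  have [//|] := newt_cancel (Qafk k _ m1f) (Qaf _ m2f) Em.
  by rewrite mulm1n.
have := congr1 (mcoeff (a *+ d)) eq0; rewrite mcoeff0 mcoeffD coef_exp raddf_sum /=.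
rewrite big_nat big1 ?addr0 => [/eqP|i /andP[i_gt0 lt_i]].
  by rewrite expf_eq0 mcoeff_eq0 af andbF.
(* A term [c_i f^(d - i)] containing [d a] would force the exponent [i a] in [c_i], hence [a] in the
   polyhedron of [Q]. *)
apply/eqP; rewrite mcoeff_eq0; apply/negP=> /msuppM_le/allpairsP[[m1 m2] /= [m1c m2f Em]].
have Pm1 : newt (fun x => Q x \/ a = x) i m1.
  have /mpow_newt : mpow P i m1 by apply: Pc m1c; rewrite i_gt0.
  by apply: newt_sub => x /sPQ; left.
have le_id : (i <= d)%N by rewrite -ltnS.
have Em' : (m1 + m2)%MM = (a *+ (i + (d - i)))%MM by rewrite subnKC.
have [//|[Em1 _]] := newt_cancel Pm1 (Qafk _ _ m2f) Em'.
apply: Na; apply: (newtV i_gt0); rewrite -Em1 muln1; apply: mpow_newt.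
by apply: mpow_sub sPQ _; apply: Pc m1c; rewrite i_gt0.
Qed.

Lemma ideal_iclos_mspan P : upclosed P ->
  ideal_iclos (mspan P) = mspan (newt P 1).
Proof.
move=> upP; have -> : ideal_iclos (mspan P) = integral_wrt (mspan_filtration P).
  have powP i : ideal_pow (mspan P) i = mspan (mpow P i) by apply: ideal_pow_mspan.
  apply/funext=> f; apply/propext; split=> -[d [c [d_gt0 [Pc eq0]]]]; exists d, c;
    by split=> //; split=> // i /Pc; rewrite powP.
apply/funext=> f; apply/propext; split=> [int_f|Pf]; last first.
  rewrite [f]mpolyE; apply: integral_wrt_sum => m /Pf[N N_gt0]; rewrite muln1 => Pm.
  apply: (integral_wrt_root N_gt0); rewrite /= exprZn mpolyXn.
  exact: mspanZX.
(* For [V = msupp f] the hypothesis is trivial; the induction then discards the points of [V] one by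
   one. *)
suff reduce (V : seq 'X_{1..n}) : {subset V <= msupp f} ->
    mspan (newt (fun x => P x \/ x \in V) 1) f -> mspan (newt P 1) f.
  refine (reduce (msupp f) _ _) => // m mf.
  by apply/mpow_newt/mpow1; right.
elim: V => [|a V IHV] sVf Vf.
  by move: Vf; apply: mspan_sub => m; apply: newt_sub => x [].
have {}Vf : mspan (newt (fun x => (P x \/ x \in V) \/ a = x) 1) f.
  move: Vf; apply: mspan_sub => m; apply: newt_sub => x [|]; first by left; left.
  by rewrite inE => /predU1P[->|]; [right | left; right].
refine (IHV _ _) => [x xV|]; first by apply: sVf; rewrite inE xV orbT.
have Va : newt (fun x => P x \/ x \in V) 1 a.
  apply: integral_newt_step int_f Vf => [m|]; first by left.
  by apply: sVf; rewrite mem_head.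
move: Vf; apply: mspan_sub => m Vm; rewrite -[1%N]muln1; apply: newt_newt.
by move: Vm; apply: newt_sub => x [Vx|<-//]; apply/mpow_newt/mpow1.
Qed.

(** The Newton polyhedron of the [k]-th power is the [k]-th dilate of that of [G]. *)
Lemma iclos_pow_monideal (G : seq 'X_{1..n}) k :
  ideal_iclos (ideal_pow (monideal K G) k) = mspan (newt (fun m => m \in G) k).
Proof.
rewrite monideal_mspan ideal_pow_mspan; last exact: mpow_up.
rewrite ideal_iclos_mspan; last exact: mpow_up.
apply: mspan_ext => m; split=> [Gm|[N N_gt0 Gm]].
  rewrite -[k]mul1n; apply: newt_newt; move: Gm; apply: newt_sub => x.
  by move=> /mpow_mpow1; apply: mpow_newt.
exists N; rewrite ?muln1 //; apply: mpow_mul.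
by move: Gm; apply: mpow_sub => x; apply: mpow1.
Qed.

Lemma ideal_bigsum_mspan k (P : nat -> 'X_{1..n} -> Prop) :
  ideal_bigsum k (fun l => mspan (P l)) =
  mspan (fun m => exists2 l, (l <= k)%N & P l m).
Proof.
transitivity (mspan (fun m => exists2 l, l \in iota 0 k.+1 & P l m)); last first.
  by apply: mspan_ext => m; split=> -[l]; rewrite ?mem_iota => lk; exists l; rewrite ?mem_iota.
rewrite /ideal_bigsum; elim: (iota 0 k.+1) => [|l r IHr] /=.
  apply/funext=> f; apply/propext; split=> [->|f0]; first exact: mspan0.
  apply/eqP; rewrite -msupp_eq0; case E: (msupp f) f0 => [|m s] // f0.
  by have [|//] := f0 m; rewrite E mem_head.
rewrite IHr ideal_add_mspan; apply: mspan_ext => m; split=> [[Pm|[l' l'r Pm]]|[l']].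
- by exists l; rewrite ?mem_head.
- by exists l'; rewrite // inE l'r orbT.
- by rewrite inE => /predU1P[->|]; [left | right; exists l'].
Qed.

End MonomialSpan.

(** * Extension of monomial ideals along an injection of variables *)

Section Extension.
Variables (K : fieldType) (r n : nat) (phi : 'I_r -> 'I_n).
Hypothesis phi_inj : injective phi.
Local Open Scope ring_scope.

Definition mres (m : 'X_{1..n}) : 'X_{1..r} := [multinom m (phi i) | i < r].
(** The exponent of the image of [x^a], zero outside the image of [phi]. *)
Definition mext (a : 'X_{1..r}) : 'X_{1..n} := (\sum_(i < r) U_(phi i) *+ a i)%MM.

Lemma mresD a b : mres (a + b) = (mres a + mres b)%MM.
Proof. by apply/mnmP=> i; rewrite !(mnmE, mnmDE). Qed.

Lemma mres0 : mres 0%MM = 0%MM.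
Proof. by apply/mnmP=> i; rewrite mnmE !mnm0E. Qed.

Lemma mres_muln a N : mres (a *+ N) = (mres a *+ N)%MM.
Proof. by apply/mnmP=> i; rewrite !(mnmE, mulmnE). Qed.

Lemma mres_le a b : (a <= b)%MM -> (mres a <= mres b)%MM.
Proof. by move=> /mnm_lepP le_ab; apply/mnm_lepP=> i; rewrite !mnmE. Qed.

Lemma mextE a i : mext a (phi i) = a i.
Proof.
rewrite mnm_sumE (bigD1 i) //= big1 => [|j ne_ji].
  by rewrite mulmnE mnm1E eqxx mul1n addn0.
by rewrite mulmnE mnm1E (inj_eq phi_inj) (negPf ne_ji).
Qed.

Lemma mextK : cancel mext mres.
Proof. by move=> a; apply/mnmP=> i; rewrite mnmE mextE. Qed.

Lemma mext_out a j : (forall i, phi i != j) -> mext a j = 0%N.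
Proof. by move=> nj; rewrite mnm_sumE big1 // => i _; rewrite mulmnE mnm1E (negPf (nj i)). Qed.

Lemma mext_res_le m : (mext (mres m) <= m)%MM.
Proof.
apply/mnm_lepP=> j; case: (pickP (fun i => phi i == j)) => [i /eqP <-|nj].
  by rewrite mextE mnmE.
by rewrite mext_out // => i; rewrite nj.
Qed.

Lemma mpow_res (P : 'X_{1..r} -> Prop) k m :
  mpow (fun x => P (mres x)) k m -> mpow P k (mres m).
Proof.
move=> [l [<- Pl le_l]]; exists (map mres l); split; first exact: size_map.
  by move=> _ /mapP[x /Pl Px ->].
apply: lepm_trans (mres_le le_l); rewrite big_map (big_morph _ mresD mres0).
exact: lepm_refl.
Qed.

Lemma newt_ext (P : 'X_{1..r} -> Prop) k m :
  newt P k (mres m) -> newt (fun x => P (mres x)) k m.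
Proof.
move=> [N N_gt0 [l [szl Pl le_l]]]; exists N => //; exists (map mext l); split.
- by rewrite size_map.
- by move=> _ /mapP[x /Pl Px ->]; rewrite mextK.
rewrite -mres_muln in le_l; apply: lepm_trans (mext_res_le _).
rewrite big_map; apply/mnm_lepP=> j; case: (pickP (fun i => phi i == j)) => [i /eqP <-|nj].
  move/mnm_lepP/(_ i): le_l; rewrite mextE; apply: leq_trans.
  by rewrite !mnm_sumE leq_sum // => x _; rewrite mextE.
by rewrite mnm_sumE big1 // => x _; rewrite mext_out // => i; rewrite nj.
Qed.

Lemma comp_mpolyX_mext a :
  'X_[a] \mPo [tuple ('X_(phi i) : {mpoly K[n]}) | i < r] = 'X_[mext a].
Proof.
rewrite comp_mpolyX -mprodXnE.
by apply: eq_bigr => i _; rewrite tnth_mktuple.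
Qed.

(** By [mext_res_le], [x^m] is a multiple of the image of [x^(mres m)]. *)
Lemma ideal_ext_mspan (P : 'X_{1..r} -> Prop) : upclosed P ->
  ideal_gen (fun y => exists x, mspan P x /\
    y = x \mPo [tuple ('X_(phi i) : {mpoly K[n]}) | i < r]) =
  mspan (fun m => P (mres m)).
Proof.
move=> upP; apply: ideal_gen_mspan => [a b Pa le_ab|_ [f [Pf ->]]|m Pm].
- by apply: upP Pa _; apply: mres_le.
- rewrite comp_mpolyEX; apply: mspan_sum => a af _; rewrite comp_mpolyX_mext.
  by apply: mspanZX; rewrite mextK; apply: Pf.
- rewrite -(submK (mext_res_le m)) mpolyXD; apply/ideal_genM/ideal_gen_base.
  by exists 'X_[mres m]; rewrite comp_mpolyX_mext; split=> //; apply: mspanX.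
Qed.

End Extension.

(** * The linear program *)

Section LinearProgram.
Local Open Scope ring_scope.

(** Turns a list of generators into multiplicities, the form in which it enters the linear
    program. *)
Lemma sum_count_mem (T : eqType) (G l : seq T) (h : T -> nat) :
    uniq G -> {subset l <= G} ->
  (\sum_(g <- G) h g * count_mem g l = \sum_(x <- l) h x)%N.
Proof.
move=> uG; elim: l => [|x l IHl] sub_lG.
  by rewrite big_nil big1 // => g _; rewrite muln0.
rewrite big_cons -IHl => [|y yl]; last by apply: sub_lG; rewrite inE yl orbT.
under eq_bigr do rewrite /= mulnDr; rewrite big_split /=; congr (_ + _)%N.
rewrite (bigD1_seq x) ?sub_lG ?mem_head //= eqxx muln1 big1 ?addn0 // => g.
by rewrite eq_sym => /negPf->; rewrite muln0.
Qed.

Lemma lp_objE k (y : 'I_k -> R) : lp_obj y = \sum_j y j.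
Proof. by []. Qed.

Lemma nu_star_upper n (G : seq 'X_{1..n}) (alpha : 'X_{1..n}) (v : R) p N :
    uniq G -> nu_star_is G alpha v -> (0 < N)%N ->
    mpow (fun m => m \in G) p (alpha *+ N)%MM ->
  p%:R <= v * N%:R.
Proof.
move=> uG [_ max_v] N_gt0 [l [<- lG /mnm_lepP le_l]].
have N_gt0R : 0 < N%:R :> R by rewrite ltr0n.
rewrite -ler_pdivrMr //.
(* Multiplicities scaled by [1 / N]: a feasible point with objective value [p / N]. *)
pose y (j : 'I_(size G)) : R := (count_mem (nth 0%MM G j) l)%:R / N%:R.
have sumE (h : 'X_{1..n} -> nat) :
    \sum_(j < size G) (h (nth 0%MM G j))%:R * y j = (\sum_(x <- l) h x)%N%:R / N%:R :> R.
  rewrite -(sum_count_mem h uG lG) (big_nth 0%MM) big_mkord natr_sum mulr_suml.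
  by apply: eq_bigr => j _; rewrite natrM mulrA.
have /max_v/RleP : lp_feasible G alpha y.
  split=> [j|i]; first by apply/RleP; rewrite divr_ge0.
  apply/RleP; rewrite INRE.
  under eq_bigr do rewrite INRE.
  rewrite [X in X <= _](sumE (fun x : 'X_{1..n} => x i)) ler_pdivrMr // -natrM ler_nat.
  by have := le_l i; rewrite mnm_sumE mulmnE.
congr (_ <= _); rewrite lp_objE.
transitivity (\sum_(j < size G) 1%N%:R * y j); first by under [RHS]eq_bigr do rewrite mul1r.
by rewrite (sumE (fun=> 1%N)) sum1_size.
Qed.

Lemma common_denominator (q : seq rat) : all (fun x => 0 <= x) q ->
  exists2 N, (0 < N)%N & forall x, x \in q -> x * N%:R \is a Num.nat.
Proof.
elim: q => [|x q IHq] /=; first by exists 1%N.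
move=> /andP[x_ge0 /IHq[N N_gt0 qN]]; exists (`|denq x| * N)%N.
  by rewrite muln_gt0 N_gt0 absz_gt0 denq_neq0.
move=> y; rewrite inE natrM => /predU1P[->|/qN yN].
  rewrite mulrA rpredM ?natr_nat //.
  have -> : x * `|denq x|%:R = `|numq x|%:R; last exact: natr_nat.
  have := numqE x; rewrite -{1}[numq x]gez0_abs ?numq_ge0 //.
  by rewrite -{1}[denq x]gez0_abs ?denq_ge0 // => <-.
by rewrite mulrCA rpredM ?natr_nat.
Qed.

(** Rational feasibility with objective at least [k] suffices: clearing denominators turns the
    solution into multiplicities of generators. *)
Lemma newt_nu_star n (G : seq 'X_{1..n}) (alpha : 'X_{1..n}) k :
  nu_star_is G alpha k%:R -> newt (fun m => m \in G) k alpha.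
Proof.
move=> [[y [[y_ge0 y_le] y_obj]] _]; set s := size G in y y_ge0 y_le y_obj.
(* Three families: [y_j >= 0], the rows of [M y <= alpha], and objective at least [k]. Index [t = s]
   holds the constant term. *)
pose c (e : 'I_s + 'I_n + unit) (t : nat) : rat := match e with
  | inl (inl j) => (t == j)%:R
  | inl (inr i) => if (t < s)%N then - (nth 0%MM G t i)%:R else (alpha i)%:R
  | inr _ => if (t < s)%N then 1 else - k%:R
  end.
(* Stated for any field [E], to be used for the real solution and then for the rational one. *)
have evalE (E : realFieldType) (x : seq E) : size x = s ->
  [/\ forall j : 'I_s, lin_eval (c (inl (inl j))) x = x`_j,
      forall i, lin_eval (c (inl (inr i))) x =
        (alpha i)%:R - \sum_(j < s) (nth 0%MM G j i)%:R * x`_j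
    & lin_eval (c (inr tt)) x = \sum_(j < s) x`_j - k%:R].
  move=> szx; split=> [j|i|]; rewrite lin_evalE szx /= ?ltnn.
  - rewrite (bigD1 j) //= eqxx rmorph1 mul1r big1 => [|j' ne_j].
      by rewrite gtn_eqF // rmorph0 !addr0.
    by rewrite (inj_eq val_inj) (negPf ne_j) rmorph0 mul0r.
  - rewrite addrC rmorph_nat; congr (_ + _); rewrite -sumrN; apply: eq_bigr => j _.
    by rewrite ltn_ord rmorphN rmorph_nat mulNr.
  - rewrite rmorphN rmorph_nat; congr (_ - _); apply: eq_bigr => j _.
    by rewrite ltn_ord rmorph1 mul1r.
pose x := [seq y j | j <- enum 'I_s].
have szx : size x = s by rewrite size_map size_enum_ord.
have xE (j : 'I_s) : x`_j = y j by rewrite (nth_map j) ?size_enum_ord // nth_ord_enum.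
have [E1 E2 E3] := evalE _ _ szx.
have [[[j|i]|[]]|q [szq q_ge0]] := @rational_solution _ x _ c.
- by rewrite E1 xE; apply/RleP.
- rewrite E2 subr_ge0; have /RleP := y_le i; rewrite INRE; congr (is_true (_ <= _)).
  by apply: eq_bigr => j _; rewrite INRE xE.
- rewrite E3 subr_ge0; under eq_bigr do rewrite xE.
  by rewrite -lp_objE y_obj.
rewrite szx in szq; have {E1 E2 E3} [E1 E2 E3] := evalE _ _ szq.
have [|N N_gt0 qN] := @common_denominator q.
  apply/(all_nthP 0) => j; rewrite szq => lt_js.
  by have := q_ge0 (inl (inl (Ordinal lt_js))); rewrite E1.
pose w (j : nat) := Num.truncn (q`_j * N%:R).
have wE (j : 'I_s) : (w j)%:R = q`_j * N%:R.
  by rewrite truncnK // qN // mem_nth // szq.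
have N_gt0Q : 0 < N%:R :> rat by rewrite ltr0n.
(* The multiplicities total at least [N * k]; [mpow_leq] discards the surplus. *)
exists N => //; apply: (@mpow_leq _ _ _ (\sum_(j < s) w j)%N).
  rewrite -(ler_nat rat) natr_sum natrM mulrC.
  under [X in _ <= X]eq_bigr do rewrite wE.
  rewrite -mulr_suml ler_pM2r //.
  by have := q_ge0 (inr tt); rewrite E3 subr_ge0.
exists (flatten [seq nseq (w (j : 'I_s)) (nth 0%MM G j) | j <- enum 'I_s]); split.
- rewrite size_flatten /shape -map_comp sumnE big_map big_enum /=.
  by apply: eq_bigr => j _; rewrite size_nseq.
- move=> m /flatten_mapP[j _]; rewrite mem_nseq => /andP[_ /eqP->].
  by rewrite mem_nth.
- apply/mnm_lepP=> i; rewrite mulmnE mnm_sumE big_flatten big_map big_enum /=.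
  rewrite -(ler_nat rat) natr_sum natrM.
  rewrite (eq_bigr (fun j : 'I_s => ((nth 0%MM G j i)%:R * q`_j) * N%:R)).
    rewrite -mulr_suml ler_pM2r //.
    by have := q_ge0 (inl (inr i)); rewrite E2 subr_ge0.
  by move=> j _; rewrite big_nseq iter_addn_0 natrM wE mulrA.
Qed.

End LinearProgram.

Theorem theorem2p5 (K : fieldType) (r s : nat)
    (G : seq 'X_{1..r}) (H : seq 'X_{1..s}) :
  minimal_gens G ->
  (forall alpha : 'X_{1..r}, exists z : Z, nu_star_is G alpha (IZR z)) ->
  forall k : nat,
    ideal_eq
      (ideal_iclos
         (ideal_pow (ideal_add (extA s (monideal K G)) (extB r (monideal K H))) k))
      (ideal_bigsum k (fun l =>
         ideal_mul (extA s (ideal_iclos (ideal_pow (monideal K G) l)))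
                   (extB r (ideal_iclos (ideal_pow (monideal K H) (k - l)))))).
Proof.
move=> [uG _] nuG k.
set lp := mres (@lshift r s); set rp := mres (@rshift r s).
have linj : injective (@lshift r s) := @lshift_inj r s.
have rinj : injective (@rshift r s) := @rshift_inj r s.
have extAE P : upclosed P -> extA s (mspan (K := K) P) = mspan (fun m => P (lp m)).
  exact: ideal_ext_mspan.
have extBE P : upclosed P -> extB r (mspan (K := K) P) = mspan (fun m => P (rp m)).
  exact: ideal_ext_mspan.
pose inG := fun m : 'X_{1..r} => m \in G; pose inH := fun m : 'X_{1..s} => m \in H.
(* The exponents of [I + J] in [S]; [mpow _ 1] is upward closure. *)
pose U m := mpow inG 1 (lp m) \/ mpow inH 1 (rp m).
have upU : upclosed U.
  move=> a b [Ga|Hb] le_ab; [left | right].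
    by apply: mpow_up Ga _; apply: mres_le.
  by apply: mpow_up Hb _; apply: mres_le.
pose V l m := exists a b,
  [/\ newt inG l (lp a), newt inH (k - l) (rp b) & (a + b <= m)%MM].
suff -> : ideal_iclos (ideal_pow (ideal_add (extA s (monideal K G))
            (extB r (monideal K H))) k)
  = ideal_bigsum k (fun l =>
         ideal_mul (extA s (ideal_iclos (ideal_pow (monideal K G) l)))
                   (extB r (ideal_iclos (ideal_pow (monideal K H) (k - l))))) by [].
transitivity (mspan (K := K) (newt (mpow U k) 1)).
  rewrite !monideal_mspan extAE; last exact: mpow_up.
  rewrite extBE; last exact: mpow_up.
  rewrite ideal_add_mspan ideal_pow_mspan // ideal_iclos_mspan //.
  exact: mpow_up.
transitivity (mspan (K := K) (fun m => exists2 l, (l <= k)%N & V l m)); last first.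
  rewrite -ideal_bigsum_mspan; congr ideal_bigsum; apply/funext=> l.
  rewrite !iclos_pow_monideal extAE; last exact: newt_up.
  by rewrite extBE ?ideal_mul_mspan //; exact: newt_up.
apply: mspan_ext => m; split; last first.
  move=> [l le_lk [a [b [Ga Hb le_m]]]].
  have [N N_gt0 Um] : newt U k m.
    apply: newt_up le_m; rewrite -(subnKC le_lk); apply: newtD.
      by have := newt_ext linj Ga; apply: newt_sub => x Gx; left; apply: mpow1.
    by have := newt_ext rinj Hb; apply: newt_sub => x Hx; right; apply: mpow1.
  by exists N; rewrite ?muln1 //; apply: mpow_mul.
move=> Um.
have {Um} : newt U k m.
  by rewrite -[k]mul1n; apply: newt_newt; move: Um; apply: newt_sub => x /mpow_newt.
case=> N N_gt0 /mpow_split[i [j [b [c [Eij Gb Hc le_m]]]]].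
move: Gb Hc => /mpow_res/mpow_mpow1 Gb /mpow_res/mpow_mpow1 Hc.
have {}Gb : mpow inG i (lp m *+ N)%MM.
  apply: mpow_up Gb _; rewrite -mres_muln; apply: mres_le; apply: lepm_trans le_m.
  exact: lem_addr.
have {}Hc : mpow inH j (rp m *+ N)%MM.
  apply: mpow_up Hc _; rewrite -mres_muln; apply: mres_le; apply: lepm_trans le_m.
  exact: lem_addl.
have [l nu_l] : exists l : nat, nu_star_is G (lp m) l%:R%R.
  have [z nu_z] := nuG (lp m); exists (Z.to_nat z).
  suff <- : IZR z = (Z.to_nat z)%:R%R by [].
  (* The empty sum of generators ([p = 0], [N = 1]) gives [z >= 0], so [Z.to_nat] preserves the
     value. *)
  have := nu_star_upper uG nu_z (ltn0Sn 0) (mpow0 _ _).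
  rewrite mulr1 => /RleP/le_IZR z_ge0.
  by rewrite -INRE INR_IZR_INZ Z2Nat.id.
have le_i : (i <= l * N)%N.
  by have := nu_star_upper uG nu_l N_gt0 Gb; rewrite -natrM ler_nat.
exists (minn l k); first exact: geq_minr.
(* The [X]-part and the [Y]-part of [m], whose sum is [m]. *)
exists (mext (@lshift r s) (lp m)), (mext (@rshift r s) (rp m)).
rewrite /lp /rp !mextK // -/lp -/rp; split.
- by apply: newt_leq (newt_nu_star nu_l); apply: geq_minl.
(* From [i + j = N k] and [i <= l N] follows [j >= N (k - l)]; if [l >= k], the required power is
   the zeroth. *)
- by exists N => //; apply: mpow_leq Hc; nia.
- apply/mnm_lepP=> x; rewrite mnmDE; case: (split_ordP x) => y ->.
    by rewrite mextE // [X in (_ + X)%N]mext_out ?addn0 ?mnmE // => t; rewrite eq_rlshift.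
  by rewrite mextE // [X in (X + _)%N]mext_out ?add0n ?mnmE // => t; rewrite eq_lrshift.
Qed.
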